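(* Let $\mathbb{F}=\mathbb{F}_q$, $n:=q-1$, $1\le k\le \frac n2$, and let $\alpha\in\mathbb{F}$ have multiplicative order $n$. Let $A=\mathbb{F}[x]/\langle x^n-1\rangle$, let $\sigma\in\mathrm{Aut}_{\mathbb{F}}(A)$ be given by $\sigma(x)=\alpha^kx$, for $0\le i\le n-1$ let $\varepsilon^{(i)}\in A$ be the primitive idempotent corresponding to the factor $x-\alpha^i$ of $x^n-1$, and let $c:=\varepsilon^{(n-k)}+\cdots+\varepsilon^{(n-1)}$. Let $b:=\lfloor\frac nk\rfloor-1$ and $1\le m\le b$. Let $G=\sum_{\nu=0}^m z^\nu G_\nu\in\mathbb{F}[z]^{k\times n}$, where $G_\nu\in\mathbb{F}^{k\times n}$ has rows $\mathfrak{v}(\sigma^\nu(c)),\mathfrak{v}(\sigma^\nu(xc)),\ldots,\mathfrak{v}(\sigma^\nu(x^{k-1}c))$, and let $\mathcal{C}=\mathrm{im}\,G\subseteq\mathbb{F}[z]^n$. Then (1) $\mathrm{dist}(\mathcal{C})=(m+1)(n-k+1)$. (2) $\hat d^{\,r}_j\ge (m+1)(n-k+1)+(j-1-m)\big(n-k(m+1)+1\big)$ for all $j\ge m+1$. In other words, the extended row distances of $\mathcal{C}$ are bounded from below by a linear function of $j$ with slope $n-k(m+1)+1$.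
   Context: $\varepsilon^{(i)}$ is the unique element of $A$ with $\varepsilon^{(i)}\equiv\delta_{ij}\bmod (x-\alpha^j)$ for all $0\le j\le n-1$. The map $\mathfrak{v}:A\to\mathbb{F}^n$ is the coefficient map $\sum_{i=0}^{n-1}v_ix^i\mapsto(v_0,\dots,v_{n-1})$. For $G\in\mathbb{F}[z]^{k\times n}$, $\mathrm{im}\,G=\{uG\mid u\in\mathbb{F}[z]^k\}$. For $v=\sum_{j}v_jz^j\in\mathbb{F}[z]^n$ with $v_j\in\mathbb{F}^n$, the weight is $\mathrm{wt}(v)=\sum_j\mathrm{wt}(v_j)$, with $\mathrm{wt}(v_j)$ the Hamming weight; $\mathrm{dist}(\mathcal{C})=\min\{\mathrm{wt}(v)\mid v\in\mathcal{C},\ v\ne0\}$. The matrix $G$ is a minimal right-invertible matrix all of whose row degrees equal $m$. For such a code the $j$th extended row distance ($j\ge m+1$) is $$\hat d^{\,r}_j:=\min\{\mathrm{wt}(uG)\mid u\in\mathbb{F}[z]^k,\ u_0\ne0,\ \deg u=j-m-1,\ \text{no } m \text{ consecutive coefficients of } u \text{ are zero}\},$$ where $u=\sum_{i=0}^{j-m-1}u_iz^i$ with $u_i\in\mathbb{F}^k$, and the condition on consecutive coefficients refers to $u_0,\dots,u_{j-m-1}$. *)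

(* Defs.v *)
From HB Require Import structures.
From mathcomp Require Import all_boot all_order all_algebra.
From mathcomp Require Import qpoly boolp classical_sets.

Set Implicit Arguments.
Unset Strict Implicit.
Unset Printing Implicit Defensive.

Import GRing.Theory.
Local Open Scope classical_set_scope.
Local Open Scope ring_scope.

(* The minimum of a set of naturals; the junk value for the empty set is 0. *)
Definition natmin (S : set nat) : nat :=
  xget 0%N [set d | S d /\ forall e, S e -> (d <= e)%N].

(* {poly %/ h} is a genuine quotient by h only when h is monic of size > 1,
   which holds for 'X^n - 1 as soon as 0 < n. *)
Notation cyclic_alg F n := {poly %/ ('X^n - 1 : {poly F})}.
Notation cyclic_X F n := (qpolyX ('X^n - 1 : {poly F})).

Definition congr_mod (A : comNzRingType) (p a b : A) : Prop :=
  exists r : A, a - b = p * r.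

Definition coef_vec (F : fieldType) (n : nat) (a : cyclic_alg F n) : 'rV[F]_n :=
  \row_(l < n) (a : {poly F})`_l.

Section PolynomialVectors.

Variable F : fieldType.

Definition vcoef (n : nat) (v : 'rV[{poly F}]_n) (j : nat) : 'rV[F]_n :=
  \row_(i < n) (v ord0 i)`_j.

(* As for [size] on {poly F}: 1 + the degree of v in z, and 0 if v = 0. *)
Definition vsize (n : nat) (v : 'rV[{poly F}]_n) : nat :=
  \max_(i < n) size (v ord0 i).

Definition hamming_wt (n : nat) (w : 'rV[F]_n) : nat := #|[pred i | w ord0 i != 0]|.

Definition wt (n : nat) (v : 'rV[{poly F}]_n) : nat :=
  \sum_(j < vsize v) hamming_wt (vcoef v j).

Definition im (k n : nat) (G : 'M[{poly F}]_(k, n)) : set 'rV[{poly F}]_n :=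
  [set v | exists u : 'rV[{poly F}]_k, v = u *m G].

Definition dist (n : nat) (C : set 'rV[{poly F}]_n) : nat :=
  natmin [set d | exists v, [/\ C v, v != 0 & d = wt v]].

(* [m] is meant to be the common row degree of G, and m + 1 <= j. *)
Definition ext_row_dist (k n : nat) (G : 'M[{poly F}]_(k, n)) (m j : nat) : nat :=
  natmin [set d | exists u : 'rV[{poly F}]_k,
    [/\ vcoef u 0 != 0,
        vsize u = (j - m - 1).+1,
        ~ (exists i, (i + m <= (j - m - 1).+1)%N /\
             forall s, (s < m)%N -> vcoef u (i + s) = 0)
      & d = wt (u *m G)]].

End PolynomialVectors.

Section Encoder.

Variables (F : fieldType) (n k : nat).
Variables (sigma : cyclic_alg F n -> cyclic_alg F n) (c : cyclic_alg F n).

Definition encoder_coef (nu : nat) : 'M[F]_(k, n) :=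
  \matrix_(i < k) coef_vec (iter nu sigma (cyclic_X F n ^+ i * c)).

Definition encoder (m : nat) : 'M[{poly F}]_(k, n) :=
  \sum_(nu < m.+1) 'X^nu *: map_mx polyC (encoder_coef nu).

End Encoder.

(* Main.v *)
(* Evaluation at the powers of alpha turns C into a stack of Reed-Solomon codes:
   c becomes the indicator of the exponents [n-k, n), so u G_nu is a vector whose
   evaluations are supported on the nu-th of m+1 disjoint blocks of k consecutive
   exponents, and it vanishes only if u does. A coefficient of uG to which the
   blocks lo..hi may contribute, if nonzero, thus has n - k(hi - lo + 1)
   consecutive zeros and, by the BCH bound, weight at least
   n + 1 - k(hi - lo + 1). If u is supported on d + 1 consecutive degrees, uG has
   d + m + 1 coefficients, whose numbers of blocks add up to (m + 1)(d + 1); when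
   none of them vanishes, summing gives exactly the bound (2). For d > m the first
   and the last m + 1 coefficients alone suffice for the bound (1), which is
   attained by a constant u since sigma preserves the Hamming weight. *)
Require Import Defs.
From HB Require Import structures.
From mathcomp Require Import all_boot all_order all_algebra.
From mathcomp Require Import qpoly boolp classical_sets.
From mathcomp Require Import zify.
Import GRing.Theory.
Local Open Scope ring_scope.

Set Implicit Arguments.
Unset Strict Implicit.
Unset Printing Implicit Defensive.

(** * Minima of sets of naturals *)

Section NatMin.

Implicit Types (S : set nat) (b d : nat).

Lemma natmin_eq S d : S d -> (forall e, S e -> (d <= e)%N) -> natmin S = d.
Proof.
move=> Sd led; apply: xget_unique => // e [Se lee].
by apply/eqP; rewrite eqn_leq lee ?led.
Qed.

(** Existence is required because [natmin] takes the junk value 0 on the empty set. *)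
Lemma le_natmin S b :
  (exists d, S d) -> (forall e, S e -> (b <= e)%N) -> (b <= natmin S)%N.
Proof.
move=> exS leb.
have exS' : exists d, `[< S d >] by case: exS => d Sd; exists d; apply/asboolP.
have [d /asboolP Sd dmin] := ex_minnP exS'.
by rewrite (@natmin_eq S d) ?leb // => e /asboolP /dmin.
Qed.

End NatMin.

(** * Weights of polynomial vectors and the BCH bound *)

Section Weight.

Variables (F : fieldType) (n : nat).
Implicit Types (v : 'rV[{poly F}]_n) (w : 'rV[F]_n).

Lemma vcoef_default v t : (vsize v <= t)%N -> vcoef v t = 0.
Proof.
move=> le_vt; apply/rowP => i; rewrite !mxE nth_default //.
apply: leq_trans le_vt; exact: (@leq_bigmax_cond _ predT (fun i => size (v ord0 i)) i isT).
Qed.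

Lemma vcoef_neq0_lt v t : vcoef v t != 0 -> (t < vsize v)%N.
Proof. by apply: contraR; rewrite -leqNgt => /vcoef_default ->. Qed.

Lemma eq0_vcoef v : (forall t, vcoef v t = 0) -> v = 0.
Proof.
move=> v0; apply/rowP => i; apply/polyP => t.
by have /rowP/(_ i) := v0 t; rewrite !mxE coef0.
Qed.

Lemma hamming_wt0 : hamming_wt (0 : 'rV[F]_n) = 0%N.
Proof. by apply: eq_card0 => i; rewrite !inE mxE eqxx. Qed.

Lemma wt_widen v D :
  (vsize v <= D)%N -> wt v = (\sum_(t < D) hamming_wt (vcoef v t))%N.
Proof.
move=> le_vD; rewrite /wt (big_ord_widen _ (fun t => hamming_wt (vcoef v t)) le_vD).
rewrite big_mkcond /=; apply: eq_bigr => t _; case: ltnP => // le_vt.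
by rewrite vcoef_default // hamming_wt0.
Qed.

Lemma leq_sum_wt v s D :
  (\sum_(t < D) hamming_wt (vcoef v (s + t)) <= wt v)%N.
Proof.
rewrite (@wt_widen v (s + D + vsize v)) ?leq_addl // !big_split_ord /=.
by rewrite -addnA addnCA leq_addr.
Qed.

End Weight.

(* Pairing the entries of [f] with the values at the nodes of the polynomial
   vanishing on all but one of the nodes [alpha ^ l] in the support of [f]
   isolates a single entry. *)
Lemma bch_bound (F : fieldType) (n : nat) (alpha : F) (a L : nat) (w : 'rV[F]_n) :
  n.-primitive_root alpha -> w != 0 ->
  (forall s, (s < L)%N -> (rVpoly w).[alpha ^+ (a + s)] = 0) ->
  (L < hamming_wt w)%N.
Proof.
move=> prim /rV0Pn[i wi] w_roots; rewrite ltnNge; apply/negP => wt_le.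
(* The sum is linear in [p], and at [p = 'X^s] it is the value of [w] at [alpha ^+ (a + s)]; so it
   kills every [p] of size at most [L]. *)
have pairing (p : {poly F}) : (size p <= L)%N ->
    \sum_l w ord0 l * alpha ^+ (a * l) * p.[alpha ^+ l] = 0.
  move=> le_pL; transitivity (\sum_(s < L) p`_s * (rVpoly w).[alpha ^+ (a + s)]).
    under [RHS]eq_bigr => s _.
      rewrite (horner_coef_wide _ (size_poly _ _)) mulr_sumr; over.
    rewrite exchange_big /=; apply: eq_bigr => l _.
    rewrite (horner_coef_wide _ le_pL) mulr_sumr; apply: eq_bigr => s _.
    rewrite coef_rVpoly_ord -!exprM mulnDl exprD [(s * l)%N]mulnC.
    by rewrite -mulrA [RHS]mulrCA; congr (_ * _); rewrite mulrCA.
  by rewrite big1 // => s _; rewrite w_roots ?mulr0.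
pose p := \prod_(l | (w ord0 l != 0) && (l != i)) ('X - (alpha ^+ l)%:P).
(* The product has one factor fewer than the weight of [w], so its size is at most that weight. *)
have /pairing : (size p <= L)%N.
  rewrite /p -big_filter size_prod_XsubC size_filter -sum1_count sum1_card.
  apply: leq_trans wt_le.
  rewrite /hamming_wt [X in (_ <= X)%N](cardD1 i) !inE wi add1n.
  by apply/subset_leq_card/fintype.subsetP => l; rewrite !inE unfold_in andbC.
rewrite (bigD1 i) //= big1 ?addr0 => [|l li].
  apply/eqP; rewrite !mulf_neq0 ?expf_neq0 ?(prim_root_eq0 prim) -?lt0n
    ?(prim_order_gt0 prim) //.
  rewrite /p horner_prod; apply/prodf_neq0 => l /andP[_ li].
  rewrite hornerXsubC subr_eq0 (eq_prim_root_expr prim) !modn_small //.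
  by rewrite eq_sym.
have [->|wl] := eqVneq (w ord0 l) 0; first by rewrite !mul0r.
by rewrite /p horner_prod (bigD1 l) /= ?wl // hornerXsubC subrr mul0r mulr0.
Qed.

(** * Evaluation in the cyclic algebra and the action of [sigma] *)

Section CyclicAlgebra.

Variables (F : fieldType) (n : nat).
Hypothesis n_gt0 : (0 < n)%N.
Implicit Types (a b : cyclic_alg F n) (p : {poly F}) (x : F).

Lemma mk_monic_cyclic : mk_monic ('X^n - 1 : {poly F}) = 'X^n - 1.
Proof. by rewrite /mk_monic -polyC1 size_XnsubC // monicXnsubC // ltnS n_gt0. Qed.

Lemma size_cyclic_alg a : (size (a : {poly F}) <= n)%N.
Proof.
have size_h : size (mk_monic ('X^n - 1 : {poly F})) = n.+1.
  by rewrite mk_monic_cyclic -polyC1 size_XnsubC.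
by have := size_mk_monic a; rewrite [X in (_ < X)%N]size_h.
Qed.

Lemma in_qpoly_cyclic p :
  (size p <= n)%N -> in_qpoly ('X^n - 1) p = p :> {poly F}.
Proof.
by move=> le_pn; rewrite in_qpoly_small // mk_monic_cyclic -polyC1 size_XnsubC.
Qed.

Lemma comp_poly_scaleX y p :
  p \Po (y *: 'X) = \poly_(l < size p) (y ^+ l * p`_l).
Proof.
rewrite comp_polyE poly_def; apply: eq_bigr => i _.
by rewrite exprZn scalerA mulrC.
Qed.

Lemma in_qpolyK a : in_qpoly ('X^n - 1) a = a.
Proof. by apply/val_inj/in_qpoly_cyclic/size_cyclic_alg. Qed.

(** The modulus vanishes at every [n]-th root of unity, so evaluation there factors through the
    quotient. *)
Lemma horner_in_qpoly p x : x ^+ n = 1 -> (in_qpoly ('X^n - 1) p).[x] = p.[x].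
Proof.
move=> xn1; have mon := monic_mk_monic ('X^n - 1 : {poly F}).
rewrite [in RHS](Pdiv.RingMonic.rdivp_eq mon p) hornerD hornerM.
by rewrite [X in _ = _ * X.[_] + _]mk_monic_cyclic !hornerE xn1 subrr mulr0 add0r.
Qed.

Lemma horner_cyclicM a b x :
  x ^+ n = 1 -> (a * b : cyclic_alg F n).[x] = (a : {poly F}).[x] * b.[x].
Proof. by move=> xn1; rewrite -hornerM -(horner_in_qpoly (_ * _) xn1). Qed.

Lemma lrmorph_in_qpoly (sigma : {lrmorphism cyclic_alg F n -> cyclic_alg F n}) y p :
  sigma (cyclic_X F n) = y *: cyclic_X F n ->
  sigma (in_qpoly ('X^n - 1) p) = in_qpoly ('X^n - 1) (p \Po (y *: 'X)).
Proof.
move=> sigma_X; rewrite comp_polyE -[p in LHS]coefK poly_def !linear_sum /=.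
apply: eq_bigr => i _; rewrite !linearZ /=; congr (_ *: _).
by rewrite !rmorphXn /= sigma_X linearZ.
Qed.

(** A linear ring morphism is determined by the image of the generator, so [sigma] substitutes
    [y *: 'X] for ['X]. This does not raise the degree, hence representatives need no reduction and
    the equality holds between polynomials. *)
Lemma iter_lrmorph (sigma : {lrmorphism cyclic_alg F n -> cyclic_alg F n}) y nu a :
  sigma (cyclic_X F n) = y *: cyclic_X F n ->
  iter nu sigma a = a \Po (y ^+ nu *: 'X) :> {poly F}.
Proof.
move=> sigma_X; elim: nu => [|nu IH]; first by rewrite expr0 scale1r comp_polyXr.
rewrite iterS -[iter nu _ _]in_qpolyK (lrmorph_in_qpoly _ sigma_X) IH.
rewrite in_qpoly_cyclic; last first.
  rewrite -comp_polyA comp_polyZ comp_polyX scalerA comp_poly_scaleX.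
  exact: leq_trans (size_poly _ _) (size_cyclic_alg a).
by rewrite -comp_polyA comp_polyZ comp_polyX scalerA -exprSr.
Qed.

Lemma horner_iter_lrmorph (sigma : {lrmorphism cyclic_alg F n -> cyclic_alg F n}) y nu a
    x :
  sigma (cyclic_X F n) = y *: cyclic_X F n ->
  (iter nu sigma a : {poly F}).[x] = (a : {poly F}).[y ^+ nu * x].
Proof.
by move=> sigma_X; rewrite (iter_lrmorph _ _ sigma_X) horner_comp hornerZ hornerX.
Qed.

Lemma coef_iter_lrmorph (sigma : {lrmorphism cyclic_alg F n -> cyclic_alg F n}) y nu a
    l :
  sigma (cyclic_X F n) = y *: cyclic_X F n ->
  (iter nu sigma a : {poly F})`_l = y ^+ (nu * l) * (a : {poly F})`_l.
Proof.
move=> sigma_X; rewrite (iter_lrmorph _ _ sigma_X) comp_poly_scaleX coef_poly.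
by case: ltnP => [_|le_al]; rewrite ?exprM // [in RHS]nth_default ?mulr0.
Qed.

Lemma horner_congr_mod a b x :
  x ^+ n = 1 -> congr_mod (cyclic_X F n - x%:A) a b ->
  (a : {poly F}).[x] = (b : {poly F}).[x].
Proof.
move=> xn1 [r ab]; apply/eqP; rewrite -subr_eq0 -hornerN -hornerD.
have -> : (a : {poly F}) - b = (a - b : cyclic_alg F n) by [].
rewrite ab horner_cyclicM // [X in X * _](_ : _ = 0) ?mul0r //.
rewrite hornerD hornerN (horner_in_qpoly 'X xn1) hornerX.
by rewrite [X in _ - X](_ : _ = x) ?subrr // hornerZ hornerC mulr1.
Qed.

Lemma horner_idem_sum alpha (A : pred 'I_n) (eps : 'I_n -> cyclic_alg F n) (j : 'I_n) :
  n.-primitive_root alpha ->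
  (forall i j : 'I_n,
     congr_mod (cyclic_X F n - (alpha ^+ j)%:A) (eps i) ((i == j)%:R)) ->
  (\sum_(i < n | A i) eps i : cyclic_alg F n).[alpha ^+ j] = (A j)%:R.
Proof.
move=> prim eps_def; rewrite poly_of_qpoly_sum horner_sum.
have xn1 : (alpha ^+ j) ^+ n = 1 by rewrite exprAC (prim_expr_order prim) expr1n.
under eq_bigr => i _ do
  rewrite (horner_congr_mod xn1 (eps_def i j)) qpolyC_natr -polyC_natr hornerC.
case: (boolP (A j)) => Aj; last first.
  by rewrite big1 // => i Ai; case: eqP Ai Aj => // ->; case: (A j).
rewrite (bigD1 j) //= eqxx big1 ?addr0 // => i /andP[_ /negPf ->] //.
Qed.

Section EncoderCoefficient.

Variables (k : nat) (y : F) (c : cyclic_alg F n).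
Variable sigma : {lrmorphism cyclic_alg F n -> cyclic_alg F n}.
Hypothesis sigma_X : sigma (cyclic_X F n) = y *: cyclic_X F n.
Implicit Type r : 'rV[F]_k.

(** With [r] read as a polynomial, this combination of rows is [sigma] iterated [nu] times on the
    product of [r] and [c]; each iteration scales the evaluation point by [y]. *)
Lemma horner_encoder_coef r nu x :
  y ^+ n = 1 -> x ^+ n = 1 ->
  (rVpoly (r *m encoder_coef k sigma c nu)).[x] =
  (rVpoly r).[y ^+ nu * x] * (c : {poly F}).[y ^+ nu * x].
Proof.
move=> yn1 xn1; have zn1 : (y ^+ nu * x) ^+ n = 1.
  by rewrite exprMn xn1 mulr1 exprAC yn1 expr1n.
rewrite (horner_coef_wide _ (size_poly _ _)).
rewrite (horner_coef_wide (n := k) _ (size_poly _ _)) mulr_suml.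
under eq_bigr => l _ do rewrite coef_rVpoly_ord mxE mulr_suml.
rewrite exchange_big; apply: eq_bigr => i _ /=.
transitivity (r ord0 i * (iter nu sigma (cyclic_X F n ^+ i * c) : {poly F}).[x]).
  rewrite (horner_coef_wide _ (size_cyclic_alg _)) mulr_sumr.
  by apply: eq_bigr => l _; rewrite !mxE mulrA.
rewrite (horner_iter_lrmorph _ _ _ sigma_X) horner_cyclicM // coef_rVpoly_ord mulrA.
by rewrite -[qpolyX _ ^+ i]rmorphXn horner_in_qpoly // hornerXn.
Qed.

Lemma encoder_coef_twist r nu (l : 'I_n) :
  (r *m encoder_coef k sigma c nu) ord0 l =
  y ^+ (nu * l) * (r *m encoder_coef k sigma c 0) ord0 l.
Proof.
rewrite !mxE mulr_sumr; apply: eq_bigr => i _.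
by rewrite !mxE (coef_iter_lrmorph _ _ _ sigma_X) mulrCA.
Qed.

(** Passing from index 0 to [nu] multiplies each entry by a power of [y], which is nonzero, so the
    support is unchanged. *)
Lemma hamming_wt_encoder_coef r nu :
  y != 0 ->
  hamming_wt (r *m encoder_coef k sigma c nu) =
  hamming_wt (r *m encoder_coef k sigma c 0).
Proof.
move=> y_neq0; apply: eq_card => l.
by rewrite !inE encoder_coef_twist mulf_eq0 expf_eq0 (negPf y_neq0) andbF.
Qed.

End EncoderCoefficient.

End CyclicAlgebra.


(** * Coefficients of a codeword and the number of blocks in each *)

Lemma vcoef_mul_encoder (F : fieldType) (n k m : nat)
    (sigma : cyclic_alg F n -> cyclic_alg F n) (c : cyclic_alg F n)
    (u : 'rV[{poly F}]_k) (t : nat) :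
  vcoef (u *m encoder k sigma c m) t =
  \sum_(nu < m.+1) (if (nu <= t)%N then vcoef u (t - nu) else 0)
                     *m encoder_coef k sigma c nu.
Proof.
apply/rowP => l; rewrite summxE !mxE coef_sum.
under eq_bigr => i _ do rewrite summxE mulr_sumr coef_sum.
rewrite exchange_big; apply: eq_bigr => nu _; rewrite mxE; apply: eq_bigr => i _ /=.
rewrite !mxE mulrCA coefXnM coefMC.
by rewrite ltnNge; case: leqP => _; rewrite ?mxE ?mul0r.
Qed.
(** The summand counts the [nu <= m] with [t - d <= nu <= t], the blocks that can reach coefficient
    [t]. The total thus counts the pairs [(nu, i)] with [nu <= m] and [i <= d], sorted by their sum
    [t]. *)
Lemma sum_block_count m d :
  (\sum_(t < d + m.+1) ((minn m t).+1 - (t - d)) = m.+1 * d.+1)%N.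
Proof.
elim: d => [|d IH].
  rewrite add0n muln1 -[RHS]card_ord -sum1_card; apply: eq_bigr => t _.
  have := ltn_ord t; lia.
(* Raising [d] by one adds one block at exactly the [m + 1] positions [t > d]. *)
rewrite (eq_bigr (fun t : 'I__ => ((minn m t).+1 - (t - d) + (d < t))%N)); last first.
  move=> t _; have := ltn_ord t; lia.
rewrite big_split /= mulnS addnC -IH; congr (_ + _)%N.
  rewrite big_split_ord /= big1 ?add0n => [|t _]; last by have := ltn_ord t; lia.
  rewrite -[RHS]card_ord -sum1_card; apply: eq_bigr => t _; lia.
by rewrite addSn big_ord_recr /= [X in (_ + X)%N](_ : _ = 0)%N ?addn0 //; lia.
Qed.

Lemma hamming_wt_size (F : fieldType) (n : nat) (w : 'rV[F]_n) :
  (hamming_wt w <= size (rVpoly w))%N.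
Proof.
rewrite /hamming_wt cardE -(size_map val) -[leqRHS](size_iota 0).
apply: uniq_leq_size => [|_ /mapP[i + ->]].
  by rewrite (map_inj_uniq val_inj) enum_uniq.
rewrite mem_enum inE mem_iota add0n -(coef_rVpoly_ord w); apply: contraR.
by rewrite -leqNgt => le_wi; rewrite nth_default.
Qed.

(** * Weight bounds for codewords *)

Section EncoderBounds.

Variables (F : fieldType) (n k m : nat) (alpha : F).
Hypothesis prim : n.-primitive_root alpha.
Hypothesis k_gt0 : (0 < k)%N.
Hypothesis kSm_le : (k * m.+1 <= n)%N.
Variables (sigma : {lrmorphism cyclic_alg F n -> cyclic_alg F n}).
Hypothesis sigma_X : sigma (cyclic_X F n) = alpha ^+ k *: cyclic_X F n.
Variable c : cyclic_alg F n.
Hypothesis horner_c : forall e, (c : {poly F}).[alpha ^+ e] = (n - k <= e %% n)%N%:R.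

Local Notation Gc := (encoder_coef k sigma c).
Local Notation G := (encoder k sigma c m).

Let n_gt0 : (0 < n)%N := prim_order_gt0 prim.

Let alpha_exp_n e : (alpha ^+ e) ^+ n = 1.
Proof. by rewrite exprAC (prim_expr_order prim) expr1n. Qed.

Let alpha_neq0 : alpha != 0.
Proof. by rewrite (prim_root_eq0 prim) -lt0n. Qed.

Let alpha_inj e f : (e < n)%N -> (f < n)%N -> (alpha ^+ e == alpha ^+ f) = (e == f).
Proof. by move=> en fn; rewrite (eq_prim_root_expr prim) !modn_small. Qed.

(** For [nu <= m] and [e < n] the indicator selects [n - k * nu.+1 <= e < n - k * nu], the [nu]-th
    block. *)
Lemma horner_block r nu e :
  (rVpoly (r *m Gc nu)).[alpha ^+ e] =
  (rVpoly r).[alpha ^+ (k * nu + e)] * (n - k <= (k * nu + e) %% n)%N%:R.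
Proof.
by rewrite (horner_encoder_coef n_gt0 _ sigma_X) // -exprM -exprD horner_c.
Qed.

Lemma block_wt_bound (r : nat -> 'rV[F]_k) lo hi :
  (hi <= m)%N -> (forall nu, r nu != 0 -> (lo <= nu <= hi)%N) ->
  (exists nu, r nu != 0) ->
  (n < hamming_wt (\sum_(nu < m.+1) r nu *m Gc nu) + k * (hi.+1 - lo))%N.
Proof.
move=> hi_le r_supp [mu r_mu]; have /andP[lo_mu mu_hi] := r_supp _ r_mu.
have le_mu : (mu < m.+1)%N by lia.
set w := \sum_(nu < _) _.
have horner_w e : (rVpoly w).[alpha ^+ e] =
    \sum_(nu < m.+1) (rVpoly (r nu)).[alpha ^+ (k * nu + e)]
                       * (n - k <= (k * nu + e) %% n)%N%:R.
  rewrite linear_sum horner_sum; apply: eq_bigr => nu _; exact: horner_block.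
have kmuS : (k * mu.+1 <= n)%N by rewrite (leq_trans _ kSm_le) // leq_mul2l le_mu orbT.
(* The blocks are disjoint, so on block [mu] only the term [mu] contributes; [w = 0] would give [k]
   distinct roots to [r mu], which has size at most [k]. *)
have w_neq0 : w != 0.
  apply/eqP => w0; move/eqP: r_mu; apply.
  apply: (can_inj rVpolyK); rewrite linear0.
  apply: (@roots_geq_poly_eq0 _ _ [seq alpha ^+ (n - k + s) | s <- iota 0 k]).
  - apply/allP => _ /mapP[s + ->]; rewrite mem_iota /= add0n => lt_sk.
    pose e := (n - k * mu.+1 + s)%N.
    have := horner_w e; rewrite w0 linear0 horner0 (bigD1 (Ordinal le_mu)) //=.
    have -> : (k * mu + e = n - k + s)%N by move: kmuS; rewrite /e mulnS; lia.
    rewrite modn_small ?leq_addr ?mulr1; last lia.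
    rewrite big1 ?addr0 => [/esym/eqP //|nu].
    rewrite -val_eqE /= => nu_mu.
    have le_nu : (k * nu.+1 <= n)%N by rewrite (leq_trans _ kSm_le) // leq_mul2l ltn_ord orbT.
    suff /ltn_geF -> : ((k * nu + e) %% n < n - k)%N by rewrite mulr0.
    (* For [nu < mu] the exponent [k * nu + e] stays below [n - k]; for [nu > mu] it wraps around
       once. *)
    case: (ltngtP nu mu) nu_mu => // lt_nm _.
      have ? : (k * nu.+1 <= k * mu)%N by rewrite leq_mul2l lt_nm orbT.
      by rewrite modn_small /e; move: kmuS; rewrite mulnS; lia.
    have ? : (k * mu.+1 <= k * nu)%N by rewrite leq_mul2l lt_nm orbT.
    have -> : (k * nu + e = n + (k * nu - k * mu.+1 + s))%N.
      by rewrite /e; lia.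
    by rewrite modnDl modn_small; move: le_nu; rewrite mulnS; lia.
  - rewrite map_inj_in_uniq ?iota_uniq // => s t; rewrite !mem_iota !add0n /=.
    move=> lt_sk lt_tk /eqP.
    by rewrite alpha_inj ?eqn_add2l => [/eqP||] //; move: kmuS; rewrite mulnS; lia.
  - by rewrite size_map size_iota size_poly.
have le_hi : (k * hi.+1 <= n)%N by rewrite (leq_trans _ kSm_le) // leq_mul2l ltnS hi_le orbT.
have : (n - k * (hi.+1 - lo) < hamming_wt w)%N.
  (* The zeros start right after block [lo] and run cyclically, across the exponent [n], up to block
     [hi]. *)
  apply: (bch_bound (a := n - k * lo) prim w_neq0) => s lt_s.
  rewrite horner_w big1 // => nu _.
  have [->|/r_supp /andP[lo_nu nu_hi]] := eqVneq (r nu) 0.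
    by rewrite linear0 horner0 mul0r.
  suff /ltn_geF -> : ((k * nu + (n - k * lo + s)) %% n < n - k)%N by rewrite mulr0.
  have lo_nu' : (k * lo <= k * nu)%N by rewrite leq_mul2l lo_nu orbT.
  have nu_hi' : (k * nu.+1 <= k * hi.+1)%N by rewrite leq_mul2l ltnS nu_hi orbT.
  have -> : (k * nu + (n - k * lo + s) = n + (k * nu - k * lo + s))%N by lia.
  move: lt_s nu_hi'; rewrite mulnBr mulnS => ? ?.
  rewrite modnDl modn_small; lia.
lia.
Qed.

Section Codeword.

Variables (u : 'rV[{poly F}]_k) (s d : nat).
Hypothesis u_supp : forall i, vcoef u i != 0 -> (s <= i <= s + d)%N.

Local Notation wt_at t := (hamming_wt (vcoef (u *m G) (s + t))).

(** Block [nu] receives [vcoef u (s + t - nu)], so the support of [u] forces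
    [t - d <= nu <= minn m t]. The premise makes one of these contributions nonzero. *)
Lemma coef_wt_bound t :
  (exists2 i, vcoef u i != 0 & (i <= s + t <= i + m)%N) ->
  (n < wt_at t + k * ((minn m t).+1 - (t - d)))%N.
Proof.
move=> [i u_i /andP[i_le i_ge]]; rewrite vcoef_mul_encoder.
(* The cut-off at [m] is there because the support condition of [block_wt_bound] ranges over all
   naturals. *)
pose r nu := if (nu <= s + t)%N && (nu <= m)%N then vcoef u (s + t - nu) else 0.
rewrite [X in hamming_wt X](_ : _ = \sum_(nu < m.+1) r nu *m Gc nu).
  apply: block_wt_bound; first exact: geq_minl.
    move=> nu; rewrite /r; case: ifP; rewrite ?eqxx // => /andP[? ?] /u_supp; lia.
  exists (s + t - i)%N; rewrite /r ifT; last lia.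
  by rewrite subKn.
by apply: eq_bigr => nu _; rewrite /r leq_ord andbT.
Qed.

Lemma wt_bound_dense :
  (forall t, (t <= d + m)%N -> exists2 i, vcoef u i != 0 & (i <= s + t <= i + m)%N) ->
  (m.+1 * (n - k + 1) + d * (n - k * m.+1 + 1) <= wt (u *m G))%N.
Proof.
move=> window; apply: leq_trans (leq_sum_wt _ s (d + m.+1)).
have : (\sum_(t < d + m.+1) n.+1 <=
  \sum_(t < d + m.+1) (wt_at t + k * ((minn m t).+1 - (t - d))))%N.
  apply: leq_sum => t _; apply: coef_wt_bound; apply: window.
  have := ltn_ord t; lia.
(* The sum reads [(d + m + 1) * (n + 1) <= W + k * (m + 1) * (d + 1)], a rearrangement of the
   claim. *)
rewrite big_split -big_distrr /= sum_block_count sum_nat_const card_ord.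
set W := (\sum_(t < _) _)%N; move: kSm_le k_gt0 => ? ?; nia.
Qed.

Lemma wt_bound_free :
  vcoef u s != 0 -> vcoef u (s + d) != 0 ->
  (m.+1 * (n - k + 1) <= wt (u *m G))%N.
Proof.
(* For [d <= m] each window in question contains [s] or [s + d], so the dense bound applies. *)
move=> u_s u_d; case: (leqP d m) => [le_dm|lt_md].
  apply: leq_trans (leq_addr _ _) (wt_bound_dense _) => t le_t.
  case: (leqP t m) => ?; [exists s | exists (s + d)%N] => //; lia.
(* For [d > m], position [i] of the first [m + 1] is paired with [d + i]. They involve blocks [0..i]
   and [i..m], so the pair has weight at least [2 * (n + 1) - k * (m + 2)], which exceeds
   [n - k + 1] since [k * m.+1 <= n]. *)
apply: leq_trans (leq_sum_wt _ s (m.+1 + (d - m.+1) + m.+1)).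
rewrite !big_split_ord /= -addnA.
apply: (@leq_trans (\sum_(i < m.+1) (wt_at i + wt_at (d + i)))); last first.
  rewrite big_split leq_add //= (leq_trans _ (leq_addl _ _)) // leq_eqVlt.
  apply/orP; left; apply/eqP/eq_bigr => i _; rewrite subnKC //.
rewrite mulnC -[X in (_ * X)%N]card_ord mulnC -sum_nat_const; apply: leq_sum => i _.
have le_i := ltn_ord i.
have H1 : (n < wt_at i + k * i.+1)%N.
  have : (n < wt_at i + k * ((minn m i).+1 - (i - d)))%N.
    by apply: coef_wt_bound; exists s => //; lia.
  by have -> : ((minn m i).+1 - (i - d) = i.+1)%N by lia.
have H2 : (n < wt_at (d + i) + k * (m.+1 - i))%N.
  have : (n < wt_at (d + i) + k * ((minn m (d + i)).+1 - (d + i - d)))%N.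
    by apply: coef_wt_bound; exists (s + d)%N => //; lia.
  by have -> : ((minn m (d + i)).+1 - (d + i - d) = m.+1 - i)%N by lia.
have : (k * i.+1 + k * (m.+1 - i) = k * m.+1 + k)%N.
  by rewrite -mulnDr -mulnSr; congr (_ * _)%N; lia.
move: kSm_le; lia.
Qed.

End Codeword.

(** The polynomial [g] with roots [alpha ^+ j] for [j < n - k] has at most [n - k + 1] nonzero
    coefficients. Its remainder modulo [h] has size at most [k] and agrees with [g] at the other [k]
    powers of [alpha], so it encodes to [g]. *)
Lemma exists_singleton_block_word :
  exists r : 'rV[F]_k, r *m Gc 0 != 0 /\ (hamming_wt (r *m Gc 0%N) <= n - k + 1)%N.
Proof.
have le_kn : (k <= n)%N by rewrite (leq_trans _ kSm_le) // leq_pmulr.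
pose g := \prod_(j < n - k) ('X - (alpha ^+ j)%:P).
pose h := \prod_(j < k) ('X - (alpha ^+ (n - k + j))%:P).
have size_g : size g = (n - k).+1.
  by rewrite size_prod_XsubC -[index_enum _]enumT size_enum_ord.
have size_h : size h = k.+1.
  by rewrite size_prod_XsubC -[index_enum _]enumT size_enum_ord.
have g_neq0 : g != 0 by rewrite -size_poly_gt0 size_g.
have size_gh : (size (modp g h) <= k)%N.
  by rewrite -ltnS -size_h ltn_modp -size_poly_gt0 size_h.
exists (poly_rV (modp g h)).
set w := _ *m _; have wE : rVpoly w = g.
  apply/eqP; rewrite -subr_eq0; apply/eqP.
  (* Both polynomials have size at most [n] and agree at all [n] powers of [alpha]. *)
  apply: (@roots_geq_poly_eq0 _ _ [seq alpha ^+ j | j <- iota 0 n]).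
  - apply/allP => _ /mapP[j + ->]; rewrite mem_iota /= add0n => lt_jn.
    rewrite /root hornerD hornerN horner_block muln0 add0n modn_small // poly_rV_K //.
    case: leqP => [le_j|lt_j]; last first.
      by rewrite mulr0 sub0r oppr_eq0 /g horner_prod (bigD1 (Ordinal lt_j)) //=
        hornerXsubC subrr mul0r.
    have lt_jk : (j - (n - k) < k)%N by lia.
    have h_root : h.[alpha ^+ j] = 0.
      by rewrite /h horner_prod (bigD1 (Ordinal lt_jk)) //= hornerXsubC
        subnKC // subrr mul0r.
    by rewrite mulr1 [in X in _ - X](divp_eq g h) hornerD hornerM
      h_root mulr0 add0r subrr.
  - rewrite map_inj_in_uniq ?iota_uniq // => s t; rewrite !mem_iota !add0n /=.
    by move=> lt_s lt_t /eqP; rewrite alpha_inj // => /eqP.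
  - rewrite size_map size_iota (leq_trans (size_polyD _ _)) //.
    by rewrite size_polyN geq_max size_poly size_g; lia.
split; first by apply: contra_neq g_neq0 => w0; rewrite -wE w0 linear0.
by rewrite addn1 -size_g -wE hamming_wt_size.
Qed.

Lemma exists_min_wt_codeword :
  exists u : 'rV[{poly F}]_k,
    u *m G != 0 /\ (wt (u *m G) <= m.+1 * (n - k + 1))%N.
Proof.
have [r [r_neq0 r_wt]] := exists_singleton_block_word.
pose u := map_mx polyC r : 'rV_k.
have vcoef_u i : vcoef u i = if i == 0%N then r else 0.
  by apply/rowP => l; rewrite !mxE coefC; case: eqP; rewrite ?mxE.
have vcoef_uG t : vcoef (u *m G) t = if (t < m.+1)%N then r *m Gc t else 0.
  rewrite vcoef_mul_encoder; case: ifP => lt_t; last first.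
    rewrite big1 // => nu _; have := ltn_ord nu => lt_nu.
    by rewrite vcoef_u ifT ?ifF ?mul0mx //; lia.
  rewrite (bigD1 (Ordinal lt_t)) //= leqnn subnn vcoef_u eqxx big1 ?addr0 // => nu.
  rewrite -val_eqE /= => nu_t; case: leqP => ?; last by rewrite mul0mx.
  by rewrite vcoef_u ifF ?mul0mx //; lia.
exists u; split.
  apply: contra_neq r_neq0 => uG0; rewrite -[LHS](vcoef_uG 0%N) uG0.
  by apply/rowP => l; rewrite !mxE coef0.
(* The enlarged range can be cut at [m.+1] without computing [vsize (u *m G)]. *)
rewrite (@wt_widen _ _ _ (m.+1 + vsize (u *m G))) ?leq_addl // big_split_ord /=.
rewrite [X in (_ + X)%N]big1 ?addn0 => [|t _]; last by rewrite vcoef_uG ifF ?hamming_wt0; lia.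
rewrite -[X in (X * _)%N]card_ord -sum_nat_const; apply: leq_sum => t _.
by rewrite vcoef_uG ltn_ord (hamming_wt_encoder_coef n_gt0 _ sigma_X) // expf_neq0.
Qed.

End EncoderBounds.

(** * Supports of polynomial vectors and conclusion *)

Lemma vcoef_lead_neq0 (F : fieldType) (n d : nat) (v : 'rV[{poly F}]_n) :
  vsize v = d.+1 -> vcoef v d != 0.
Proof.
move=> size_v; apply/eqP => v_d.
suff : (vsize v <= d)%N by rewrite size_v ltnn.
apply/bigmax_leqP => i _; apply/leq_sizeP => t.
rewrite leq_eqVlt => /orP[/eqP <-|lt_dt].
  by move/rowP: v_d => /(_ i); rewrite !mxE.
have /rowP/(_ i) : vcoef v t = 0 by rewrite vcoef_default ?size_v.
by rewrite !mxE.
Qed.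

Lemma vcoef_support (F : fieldType) (n : nat) (v : 'rV[{poly F}]_n) :
  v != 0 -> exists s d, [/\ vcoef v s != 0, vcoef v (s + d) != 0 &
    forall i, vcoef v i != 0 -> (s <= i <= s + d)%N].
Proof.
move=> v_neq0; have exs : exists s, vcoef v s != 0.
  apply: contrapT => nex; move/eqP: v_neq0; apply.
  by apply: eq0_vcoef => t; apply/eqP/negPn/negP => v_t; apply: nex; exists t.
have [s v_s s_min] := ex_minnP exs.
have [|e v_e e_max] := ex_maxnP exs (m := vsize v).
  by move=> i /vcoef_neq0_lt/ltnW.
exists s, (e - s)%N; rewrite subnKC ?s_min //; split=> // i v_i.
by rewrite s_min ?e_max.
Qed.

Theorem theorem4p3
  (F : finFieldType) (n k m : nat) (alpha : F)
  (n_def : n = #|F|.-1)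
  (k_ge1 : (1 <= k)%N) (k_le : (2 * k <= n)%N)
  (alpha_order : n.-primitive_root alpha)
  (sigma : {lrmorphism cyclic_alg F n -> cyclic_alg F n})
  (sigma_aut : bijective sigma)
  (sigma_X : sigma (cyclic_X F n) = alpha ^+ k *: cyclic_X F n)
  (eps : 'I_n -> cyclic_alg F n)
  (eps_def : forall i j : 'I_n,
     congr_mod (cyclic_X F n - (alpha ^+ j)%:A) (eps i) ((i == j)%:R))
  (m_ge1 : (1 <= m)%N) (m_le : (m <= n %/ k - 1)%N) :
  let c : cyclic_alg F n := \sum_(i < n | (n - k <= i)%N) eps i in
  let G : 'M[{poly F}]_(k, n) := encoder k sigma c m in
  dist (im G) = (m.+1 * (n - k + 1))%N /\
  (forall j : nat, (m + 1 <= j)%N ->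
     (m.+1 * (n - k + 1) + (j - 1 - m) * (n - k * m.+1 + 1)
        <= ext_row_dist G m j)%N).
Proof.
move=> c G.
have n_gt0 := prim_order_gt0 alpha_order.
(* The bound on [m] gives [m.+1 <= n %/ k]: the [m + 1] blocks fit into the [n] exponents. *)
have kSm_le : (k * m.+1 <= n)%N.
  rewrite mulnC; apply: leq_trans (leq_divM n k); rewrite leq_mul2r; lia.
have horner_c e : (c : {poly F}).[alpha ^+ e] = (n - k <= e %% n)%N%:R.
  rewrite -(prim_expr_mod alpha_order).
  pose j := Ordinal (ltn_pmod e n_gt0).
  exact: (horner_idem_sum n_gt0 (fun i : 'I_n => (n - k <= i)%N) j alpha_order eps_def).
split.
  have dist_ge v : im G v -> v != 0 -> (m.+1 * (n - k + 1) <= wt v)%N.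
    move=> [u ->] uG_neq0; have u_neq0 : u != 0.
      by apply: contra_neq uG_neq0 => ->; rewrite mul0mx.
    have [s [d [u_s u_d u_supp]]] := vcoef_support u_neq0.
    exact: (wt_bound_free alpha_order k_ge1 kSm_le sigma_X horner_c u_supp).
  apply: natmin_eq => [|_ [v [Cv v_neq0 ->]]]; last exact: dist_ge.
  have [u [uG_neq0 uG_wt]] :=
    exists_min_wt_codeword alpha_order k_ge1 kSm_le sigma_X horner_c.
  exists (u *m G); split=> //; first by exists u.
  by apply/eqP; rewrite eqn_leq uG_wt dist_ge //; exists u.
move=> j lt_mj; apply: le_natmin.
  (* A vector without zero coefficients up to degree [j - m - 1] shows that the minimum is taken
     over a nonempty set. *)
  pose u : 'rV[{poly F}]_k := const_mx (\poly_(i < (j - m - 1).+1) 1).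
  have vcoef_u i : (i <= j - m - 1)%N -> vcoef u i != 0.
    move=> le_i; apply/eqP => /rowP/(_ (Ordinal k_ge1)).
    by rewrite !mxE coef_poly ltnS le_i => /eqP; rewrite oner_eq0.
  exists (wt (u *m G)), u; split=> //; first exact: vcoef_u.
    apply/eqP; rewrite eqn_leq; apply/andP; split.
      by apply/bigmax_leqP => i _; rewrite mxE size_poly.
    by apply: vcoef_neq0_lt; apply: vcoef_u.
  (* As [m >= 1], a gap would contain at least one coefficient. *)
  move=> [i [le_i u0]]; have /eqP := u0 0%N m_ge1; apply/negP.
  by apply: vcoef_u; lia.
move=> _ [u [u_0 size_u no_gap ->]].
have u_d := vcoef_lead_neq0 size_u.
have -> : (j - 1 - m = j - m - 1)%N by lia.
apply: (wt_bound_dense alpha_order k_ge1 kSm_le sigma_X horner_c (s := 0%N)).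
  by move=> i /vcoef_neq0_lt; rewrite size_u.
move=> t le_t; rewrite add0n.
(* The window ending at [t] contains 0 if [t <= m], and the degree [j - m - 1] if that is at most
   [t]. Otherwise, if [u] vanished on the window, [m] consecutive zeros would start at [t - m]. *)
have [le_tm|lt_mt] := leqP t m; first by exists 0%N.
have [le_dt|lt_td] := leqP (j - m - 1) t; first by exists (j - m - 1)%N => //; lia.
apply: contrapT => nex; apply: no_gap; exists (t - m)%N; split; first lia.
move=> i lt_i; apply/eqP/negPn/negP => u_i; apply: nex.
by exists (t - m + i)%N => //; lia.
Qed.
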